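(* Let $\Sigma$ be a signature containing a binary relation symbol $\equiv$. Then $\mathsf{FSATEQ}(\Sigma;\equiv)\preceq\mathsf{FSAT}(\Sigma)$.
   Context: We work in constructive type theory. $p\preceq q$ means there is a function $f$ with $p\,x\leftrightarrow q(f\,x)$ for all $x$. A type is finite if some list contains all of its elements. A signature consists of a type of function symbols and a type of relation symbols, each with an arity. Formulas are first-order formulas built from $\dot\bot$, atoms, $\dot\to,\dot\land,\dot\lor,\dot\forall,\dot\exists$. A model over a domain $D$ interprets function symbols as functions $D^{|f|}\to D$ and relation symbols as predicates $D^{|P|}\to\mathbb P$, with Tarski satisfaction $\mathcal M\vDash_\rho\varphi$. The model is decidable if every relation interpretation is decidable. $\mathsf{FSAT}(\Sigma)\,\varphi$ holds iff some finite type $D$, decidable model over $D$ and assignment $\rho$ satisfy $\varphi$. $\mathsf{FSATEQ}(\Sigma;\equiv)\,\varphi$ holds iff this is possible with the model additionally satisfying $\equiv^{\mathcal M}x\,y\leftrightarrow x=y$ for all $x,y:D$. *)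

(* Defs.v *)
(* first-order logic over an arbitrary signature,
   following Kirst & Larchey-Wendling, "Trakhtenbrot's theorem in Coq". *)
From Stdlib Require Import List Vector.
Import ListNotations.

Set Implicit Arguments.

Definition reduces {X Y : Type} (p : X -> Prop) (q : Y -> Prop) : Prop :=
  exists f : X -> Y, forall x, p x <-> q (f x).

Definition finite (D : Type) : Prop := exists l : list D, forall x : D, List.In x l.

Record signature : Type := Signature {
  syms : Type;
  ar_syms : syms -> nat;
  rels : Type;
  ar_rels : rels -> nat }.

Section Syntax.
Variable Σ : signature.

(* Terms with de Bruijn variables *)
Inductive term : Type :=
  | var : nat -> term
  | func : forall f : syms Σ, Vector.t term (ar_syms Σ f) -> term.

Inductive form : Type :=
  | fal : form
  | atom : forall P : rels Σ, Vector.t term (ar_rels Σ P) -> form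
  | imp : form -> form -> form
  | conj : form -> form -> form
  | disj : form -> form -> form
  | all : form -> form
  | ex : form -> form.

Record model (D : Type) : Type := Model {
  fun_i : forall f : syms Σ, Vector.t D (ar_syms Σ f) -> D;
  rel_i : forall P : rels Σ, Vector.t D (ar_rels Σ P) -> Prop }.

Definition scons {D : Type} (d : D) (rho : nat -> D) : nat -> D :=
  fun n => match n with 0 => d | S n => rho n end.

Fixpoint eval {D : Type} (M : model D) (rho : nat -> D) (t : term) : D :=
  match t with
  | var n => rho n
  | func f v => fun_i M f (Vector.map (eval M rho) v)
  end.

Fixpoint sat {D : Type} (M : model D) (rho : nat -> D) (phi : form) : Prop :=
  match phi with
  | fal => False
  | atom P v => rel_i M P (Vector.map (eval M rho) v)
  | imp a b => sat M rho a -> sat M rho b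
  | conj a b => sat M rho a /\ sat M rho b
  | disj a b => sat M rho a \/ sat M rho b
  | all a => forall d : D, sat M (scons d rho) a
  | ex a => exists d : D, sat M (scons d rho) a
  end.

Definition model_dec {D : Type} (M : model D) : Type :=
  forall (P : rels Σ) (v : Vector.t D (ar_rels Σ P)), {rel_i M P v} + {~ rel_i M P v}.

Definition FSAT (phi : form) : Prop :=
  exists (D : Type) (M : model D) (rho : nat -> D),
    finite D /\ inhabited (model_dec M) /\ sat M rho phi.

Definition pair_vec {D : Type} (e : rels Σ) (He : ar_rels Σ e = 2) (x y : D)
  : Vector.t D (ar_rels Σ e) :=
  eq_rect 2 (Vector.t D) (Vector.cons D x 1 (Vector.cons D y 0 (Vector.nil D)))
          (ar_rels Σ e) (eq_sym He).

Definition FSATEQ (e : rels Σ) (He : ar_rels Σ e = 2) (phi : form) : Prop :=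
  exists (D : Type) (M : model D) (rho : nat -> D),
    finite D /\ inhabited (model_dec M) /\
    (forall x y : D, rel_i M e (pair_vec e He x y) <-> x = y) /\
    sat M rho phi.

End Syntax.

(* Main.v *)
(** The reduction conjoins [φ] with axioms stating that [≡] is an equivalence
    relation and a congruence for the function and relation symbols of [φ];
    they hold when [≡] is equality.  Conversely, in a finite decidable model of
    them, pick in each [≡]-class the first element of an enumeration of the
    domain.  The representatives, with the operations followed by this choice,
    form a finite decidable model in which [≡] is equality, and it satisfies [φ]
    because every symbol of [φ] respects [≡]. *)

Require Import Defs.
From Stdlib Require Import Vector List Bool Setoid ProofIrrelevance.
Import ListNotations.

Set Implicit Arguments.

Lemma find_ext {A : Type} (p q : A -> bool) (l : list A) :
  (forall x, p x = q x) -> find p l = find q l.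
Proof. intros Hpq. induction l as [|x l IHl]; cbn; [|rewrite Hpq, IHl]; reflexivity. Qed.

Lemma Forall2_map_In {A B C : Type} (P : B -> C -> Prop) (g : A -> B) (h : A -> C)
  n (v : Vector.t A n) :
  (forall x, Vector.In x v -> P (g x) (h x)) -> Vector.Forall2 P (Vector.map g v) (Vector.map h v).
Proof.
  induction v as [|x n v IHv]; intros Hv; constructor.
  - apply Hv, Vector.In_cons_hd.
  - apply IHv. intros y Hy. apply Hv, Vector.In_cons_tl, Hy.
Qed.

Lemma Forall2_eq {A : Type} (R : A -> A -> Prop) n (v w : Vector.t A n) :
  (forall x y, R x y -> x = y) -> Vector.Forall2 R v w -> v = w.
Proof. intros HR Hvw. induction Hvw; f_equal; auto. Qed.

Lemma map_pair_vec (Σ : signature) (e : rels Σ) (He : ar_rels Σ e = 2)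
  (D D' : Type) (g : D -> D') (x y : D) :
  Vector.map g (pair_vec Σ e He x y) = pair_vec Σ e He (g x) (g y).
Proof. unfold pair_vec. destruct (eq_sym He). reflexivity. Qed.

Section Syntax.
Variable Σ : signature.

Lemma term_In_ind (P : term Σ -> Prop)
  (Hvar : forall n, P (var Σ n))
  (Hfunc : forall f v, (forall t, Vector.In t v -> P t) -> P (func f v)) :
  forall t, P t.
Proof.
  fix IH 1. intros [n | f v]; [apply Hvar | apply Hfunc].
  apply Vector.Forall_forall. induction v; constructor; [apply IH | exact IHv].
Qed.

Fixpoint term_syms (t : term Σ) : list (syms Σ) :=
  match t with
  | var _ _ => []
  | func f v => f :: concat (Vector.to_list (Vector.map term_syms v))
  end.

Lemma Forall_term_syms_vec (Q : syms Σ -> Prop) n (v : Vector.t (term Σ) n) :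
  Forall Q (concat (Vector.to_list (Vector.map term_syms v))) ->
  forall t, Vector.In t v -> Forall Q (term_syms t).
Proof.
  rewrite Forall_concat, Vector.to_list_map, Forall_map.
  rewrite <- Vector.to_list_Forall, Vector.Forall_forall. exact id.
Qed.

Fixpoint form_syms (phi : form Σ) : list (syms Σ) :=
  match phi with
  | fal _ => []
  | atom _ v => concat (Vector.to_list (Vector.map term_syms v))
  | imp a b | conj a b | disj a b => form_syms a ++ form_syms b
  | all a | ex a => form_syms a
  end.

Fixpoint form_rels (phi : form Σ) : list (rels Σ) :=
  match phi with
  | fal _ => []
  | atom P _ => [P]
  | imp a b | conj a b | disj a b => form_rels a ++ form_rels b
  | all a | ex a => form_rels a
  end.

Definition top : form Σ := imp (fal Σ) (fal Σ).

Definition conjs (l : list (form Σ)) : form Σ := fold_right (@conj Σ) top l.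

Fixpoint alls (n : nat) (phi : form Σ) : form Σ :=
  match n with 0 => phi | S n => all (alls n phi) end.

(** [[var (k+n-1); ...; var k]]: [push] below binds the last entry of a vector as variable [0]. *)
Fixpoint vars (k n : nat) : Vector.t (term Σ) n :=
  match n with 0 => Vector.nil _ | S n => Vector.cons _ (var Σ (k + n)) _ (vars k n) end.

End Syntax.

Section Semantics.
Variables (Σ : signature) (D : Type) (M : model Σ D).

Fixpoint push {n} (v : Vector.t D n) (rho : nat -> D) : nat -> D :=
  match v with
  | Vector.nil _ => rho
  | Vector.cons _ x _ v => push v (scons x rho)
  end.

Lemma push_add n (v : Vector.t D n) rho j : push v rho (n + j) = rho j.
Proof.
  revert rho j. induction v as [|x n v IHv]; intros rho j; cbn [push]; [reflexivity|].
  change (S n + j) with (S (n + j)). rewrite plus_n_Sm. apply (IHv (scons x rho) (S j)).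
Qed.

Lemma map_eval_vars k n (w : Vector.t D n) sigma rho :
  (forall j, sigma (k + j) = push w rho j) -> Vector.map (eval M sigma) (vars Σ k n) = w.
Proof.
  revert rho. induction w as [|x n w IHw]; intros rho Hsigma; cbn; [reflexivity|].
  f_equal; [|exact (IHw _ Hsigma)].
  rewrite Hsigma. cbn [push]. rewrite (plus_n_O n) at 2. apply push_add.
Qed.

Lemma map_eval_vars_inner n (v w : Vector.t D n) rho :
  Vector.map (eval M (push w (push v rho))) (vars Σ 0 n) = w.
Proof. apply map_eval_vars with (rho := push v rho). reflexivity. Qed.

Lemma map_eval_vars_outer n (v w : Vector.t D n) rho :
  Vector.map (eval M (push w (push v rho))) (vars Σ n n) = v.
Proof. apply map_eval_vars with (rho := rho). intros j. apply push_add. Qed.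

Lemma sat_alls n phi rho :
  sat M rho (alls n phi) <-> forall v : Vector.t D n, sat M (push v rho) phi.
Proof.
  revert rho. induction n as [|n IHn]; intros rho; cbn [alls sat].
  - split; [intros H v | intros H; exact (H (Vector.nil _))].
    apply (Vector.case0 (fun v => sat M (push v rho) phi)), H.
  - setoid_rewrite IHn. split.
    + intros H v. apply (Vector.caseS' v). intros x w. apply H.
    + intros H x w. apply (H (Vector.cons _ x _ w)).
Qed.

Lemma sat_conjs rho l : sat M rho (conjs l) <-> Forall (sat M rho) l.
Proof.
  induction l as [|phi l IHl]; cbn [conjs fold_right sat].
  - split; [constructor | intros _ H; exact H].
  - rewrite Forall_cons_iff, <- IHl. reflexivity.
Qed.

End Semantics.

Section EqualityAxioms.
Variables (Σ : signature) (e : rels Σ) (He : ar_rels Σ e = 2).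

Definition eq_atom (t s : term Σ) : form Σ := atom e (pair_vec Σ e He t s).

Definition eq_atoms {n} (v w : Vector.t (term Σ) n) : form Σ :=
  Vector.fold_right2 (fun t s phi => conj (eq_atom t s) phi) (top Σ) n v w.

Definition equiv_ax : form Σ :=
  conj (all (eq_atom (var Σ 0) (var Σ 0)))
 (conj (all (all (imp (eq_atom (var Σ 1) (var Σ 0)) (eq_atom (var Σ 0) (var Σ 1)))))
       (all (all (all (imp (eq_atom (var Σ 2) (var Σ 1))
                      (imp (eq_atom (var Σ 1) (var Σ 0)) (eq_atom (var Σ 2) (var Σ 0)))))))).

Definition cong_fun_ax (f : syms Σ) : form Σ :=
  let n := ar_syms Σ f in
  alls n (alls n (imp (eq_atoms (vars Σ n n) (vars Σ 0 n))
                      (eq_atom (func f (vars Σ n n)) (func f (vars Σ 0 n))))).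

Definition cong_rel_ax (P : rels Σ) : form Σ :=
  let n := ar_rels Σ P in
  alls n (alls n (imp (eq_atoms (vars Σ n n) (vars Σ 0 n))
                      (imp (atom P (vars Σ n n)) (atom P (vars Σ 0 n))))).

Definition reduction (phi : form Σ) : form Σ :=
  conj phi (conj equiv_ax (conj (conjs (List.map cong_fun_ax (form_syms phi)))
                                (conjs (List.map cong_rel_ax (form_rels phi))))).

Section Satisfaction.
Variables (D : Type) (M : model Σ D).

Definition eqv (x y : D) : Prop := rel_i M e (pair_vec Σ e He x y).

Definition fun_congruent (f : syms Σ) : Prop :=
  forall v w, Vector.Forall2 eqv v w -> eqv (fun_i M f v) (fun_i M f w).

Definition rel_congruent (P : rels Σ) : Prop :=
  forall v w, Vector.Forall2 eqv v w -> rel_i M P v -> rel_i M P w.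

Lemma sat_eq_atom rho t s : sat M rho (eq_atom t s) <-> eqv (eval M rho t) (eval M rho s).
Proof. unfold eq_atom, eqv. cbn [sat]. rewrite map_pair_vec. reflexivity. Qed.

Lemma sat_eq_atoms rho n (v w : Vector.t (term Σ) n) :
  sat M rho (eq_atoms v w) <->
  Vector.Forall2 eqv (Vector.map (eval M rho) v) (Vector.map (eval M rho) w).
Proof.
  revert n v w. apply Vector.rect2; cbn.
  - split; [constructor | intros _ H; exact H].
  - intros n v w IH t s. rewrite Vector.Forall2_cons_iff, <- IH, <- sat_eq_atom. reflexivity.
Qed.

Lemma sat_equiv_ax rho : sat M rho equiv_ax <-> Equivalence eqv.
Proof.
  unfold equiv_ax. cbn [sat]. setoid_rewrite sat_eq_atom. cbn [eval scons].
  split.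
  - intros (Hrefl & Hsym & Htrans). split; assumption.
  - intros [Hrefl Hsym Htrans]. repeat split; assumption.
Qed.

Lemma sat_cong_fun_ax rho f : sat M rho (cong_fun_ax f) <-> fun_congruent f.
Proof.
  unfold cong_fun_ax. rewrite sat_alls. setoid_rewrite sat_alls. cbn [sat].
  setoid_rewrite sat_eq_atoms. setoid_rewrite sat_eq_atom. cbn [eval].
  setoid_rewrite map_eval_vars_outer. setoid_rewrite map_eval_vars_inner. reflexivity.
Qed.

Lemma sat_cong_rel_ax rho P : sat M rho (cong_rel_ax P) <-> rel_congruent P.
Proof.
  unfold cong_rel_ax. rewrite sat_alls. setoid_rewrite sat_alls. cbn [sat].
  setoid_rewrite sat_eq_atoms.
  setoid_rewrite map_eval_vars_outer. setoid_rewrite map_eval_vars_inner. reflexivity.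
Qed.

Lemma sat_reduction rho phi :
  sat M rho (reduction phi) <->
  sat M rho phi /\ Equivalence eqv /\
  Forall fun_congruent (form_syms phi) /\ Forall rel_congruent (form_rels phi).
Proof.
  unfold reduction. cbn [sat]. rewrite sat_equiv_ax, !sat_conjs, !Forall_map.
  assert (Hfun : forall l, Forall (fun f => sat M rho (cong_fun_ax f)) l <-> Forall fun_congruent l)
    by (intros l; split; apply Forall_impl; intros f; apply sat_cong_fun_ax).
  assert (Hrel : forall l, Forall (fun P => sat M rho (cong_rel_ax P)) l <-> Forall rel_congruent l)
    by (intros l; split; apply Forall_impl; intros P; apply sat_cong_rel_ax).
  rewrite Hfun, Hrel. reflexivity.
Qed.

Lemma sat_reduction_of_equality rho phi :
  (forall x y, eqv x y <-> x = y) -> sat M rho phi -> sat M rho (reduction phi).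
Proof.
  intros Heq Hphi. apply sat_reduction. repeat split.
  - exact Hphi.
  - intros x. apply Heq. reflexivity.
  - intros x y Hxy. apply Heq. symmetry. apply Heq, Hxy.
  - intros x y z Hxy Hyz. apply Heq. transitivity y; apply Heq; assumption.
  - apply Forall_forall. intros f _ v w Hvw. apply Heq. f_equal.
    apply (Forall2_eq (fun x y => proj1 (Heq x y)) Hvw).
  - apply Forall_forall. intros P _ v w Hvw.
    rewrite (Forall2_eq (fun x y => proj1 (Heq x y)) Hvw). exact id.
Qed.

End Satisfaction.
End EqualityAxioms.

Section Quotient.
Variables (Σ : signature) (e : rels Σ) (He : ar_rels Σ e = 2) (D : Type) (M : model Σ D).
Variables (dec : model_dec M) (l : list D).
Hypotheses (l_complete : forall x, In x l) (R_equiv : Equivalence (eqv e He M)).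

Local Notation R := (eqv e He M).

Definition eqvb (x y : D) : bool := if dec e (pair_vec Σ e He x y) then true else false.

Lemma eqvb_spec x y : eqvb x y = true <-> R x y.
Proof. unfold eqvb, eqv. destruct dec; easy. Qed.

(** The [None] branch is unreachable since [l] enumerates [D]. *)
Definition rep (x : D) : D :=
  match find (fun y => eqvb y x) l with Some y => y | None => x end.

Lemma rep_eqv x : R (rep x) x.
Proof.
  unfold rep. destruct (find _ l) as [y|] eqn:Hfind; [|reflexivity].
  apply find_some in Hfind as [_ Hy]. apply eqvb_spec, Hy.
Qed.

Lemma rep_eq x y : R x y -> rep x = rep y.
Proof.
  intros Hxy. unfold rep. rewrite (find_ext _ (fun z => eqvb z y)).
  - destruct (find _ l) eqn:Hfind; [reflexivity|].
    apply find_none with (x := y) in Hfind; [|apply l_complete].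
    enough (eqvb y y = true) by congruence. apply eqvb_spec. reflexivity.
  - intros z. apply Bool.eq_iff_eq_true. rewrite !eqvb_spec, Hxy. reflexivity.
Qed.

Lemma rep_idem x : rep (rep x) = rep x.
Proof. apply rep_eq, rep_eqv. Qed.

Definition quot : Type := {x : D | rep x = x}.

Definition cls (x : D) : quot := exist _ (rep x) (rep_idem x).

Lemma quot_ext (a b : quot) : R (proj1_sig a) (proj1_sig b) -> a = b.
Proof.
  destruct a as [x Hx], b as [y Hy]. cbn. intros Hxy. apply subset_eq_compat.
  rewrite <- Hx, <- Hy. apply rep_eq, Hxy.
Qed.

Lemma cls_proj (a : quot) : cls (proj1_sig a) = a.
Proof. apply quot_ext, rep_eqv. Qed.

Definition quot_model : model Σ quot :=
  Model Σ (fun f v => cls (fun_i M f (Vector.map (@proj1_sig _ _) v)))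
          (fun P v => rel_i M P (Vector.map (@proj1_sig _ _) v)).

Definition env_related (rho' : nat -> quot) (rho : nat -> D) : Prop :=
  forall i, R (proj1_sig (rho' i)) (rho i).

Lemma env_related_scons rho' rho a x :
  env_related rho' rho -> R (proj1_sig a) x -> env_related (scons a rho') (scons x rho).
Proof. intros Hrho Hax [|i]; [exact Hax | apply Hrho]. Qed.

Lemma eval_quot rho' rho t :
  env_related rho' rho -> Forall (fun_congruent e He M) (term_syms t) ->
  R (proj1_sig (eval quot_model rho' t)) (eval M rho t).
Proof.
  intros Hrho. induction t as [n | f v IH] using term_In_ind; [intros _; apply Hrho|].
  cbn [term_syms]. intros [Hf Hv]%Forall_cons_iff.
  cbn [eval quot_model fun_i cls proj1_sig]. rewrite rep_eqv.
  apply Hf. rewrite Vector.map_map. apply Forall2_map_In.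
  intros t Ht. exact (IH t Ht (Forall_term_syms_vec Hv Ht)).
Qed.

Lemma sat_quot phi rho' rho :
  Forall (fun_congruent e He M) (form_syms phi) -> Forall (rel_congruent e He M) (form_rels phi) ->
  env_related rho' rho -> (sat quot_model rho' phi <-> sat M rho phi).
Proof.
  revert rho' rho.
  induction phi as [| P v | a IHa b IHb | a IHa b IHb | a IHa b IHb | a IHa | a IHa];
    intros rho' rho Hfun Hrel Hrho; cbn [form_syms form_rels] in Hfun, Hrel; cbn [sat].
  6,7: assert (Hcls : forall x, sat quot_model (scons (cls x) rho') a <-> sat M (scons x rho) a)
         by (intros x; apply IHa; [exact Hfun | exact Hrel | apply env_related_scons, rep_eqv; exact Hrho]);
       assert (Hproj : forall x, sat quot_model (scons x rho') a <-> sat M (scons (proj1_sig x) rho) a)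
         by (intros x; apply IHa; [exact Hfun | exact Hrel | apply env_related_scons; [exact Hrho | reflexivity]]).
  3-5: apply Forall_app in Hfun as [Hfa Hfb], Hrel as [Hra Hrb];
       rewrite (IHa rho' rho Hfa Hra Hrho), (IHb rho' rho Hfb Hrb Hrho); reflexivity.
  - reflexivity.
  - cbn [quot_model rel_i]. rewrite Vector.map_map. apply Forall_inv in Hrel.
    assert (Hv : forall t, Vector.In t v -> R (proj1_sig (eval quot_model rho' t)) (eval M rho t))
      by (intros t Ht; apply eval_quot; [exact Hrho | exact (Forall_term_syms_vec Hfun Ht)]).
    split; apply Hrel, Forall2_map_In; intros t Ht; [|symmetry]; apply Hv, Ht.
  - split; intros H x; [apply Hcls | apply Hproj]; apply H.
  - split; intros [x H]; [exists (proj1_sig x); apply Hproj | exists (cls x); apply Hcls]; exact H.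
Qed.

Lemma FSATEQ_quot rho phi :
  sat M rho phi -> Forall (fun_congruent e He M) (form_syms phi) ->
  Forall (rel_congruent e He M) (form_rels phi) -> FSATEQ e He phi.
Proof.
  intros Hphi Hfun Hrel. exists quot, quot_model, (fun i => cls (rho i)). split; [|split; [|split]].
  - exists (List.map cls l). intros a. rewrite <- (cls_proj a). apply in_map, l_complete.
  - constructor. intros P v. apply dec.
  - intros a b. cbn [quot_model rel_i]. rewrite map_pair_vec.
    change (R (proj1_sig a) (proj1_sig b) <-> a = b). split; [apply quot_ext | intros <-; reflexivity].
  - apply (sat_quot phi Hfun Hrel (rho := rho)); [intros i; apply rep_eqv | exact Hphi].
Qed.

End Quotient.

Theorem theorem21 (Σ : signature) (e : rels Σ) (He : ar_rels Σ e = 2) :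
  reduces (@FSATEQ Σ e He) (@FSAT Σ).
Proof.
  exists (reduction e He). intros phi. split.
  - intros (D & M & rho & Hfin & Hdec & Heq & Hphi).
    exists D, M, rho. split; [exact Hfin | split; [exact Hdec |]].
    exact (sat_reduction_of_equality e He M rho phi Heq Hphi).
  - intros (D & M & rho & [l Hl] & [dec] & Hred).
    apply sat_reduction in Hred as (Hphi & Hequiv & Hfun & Hrel).
    exact (FSATEQ_quot dec l Hl Hequiv rho phi Hphi Hfun Hrel).
Qed.
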